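(* The geodesics of $H^1$ are exactly the horizontally regular curves with vanishing $T$-variation and constant $p$-curvature; that is, a horizontally regular curve (defined on an open interval) is, up to reparametrization, a geodesic of $H^1$ if and only if $\tau=0$ and $k=c$ for some constant $c\in\mathbb{R}$, and every (non-constant) geodesic is such a curve.
   Context: $H^1$ is $\mathbb{R}^3$ with coordinates $(x,y,z)=(x^1,x^2,x^3)$, group law $(x_1,y_1,z_1)\circ(x_2,y_2,z_2)=(x_1+x_2,\,y_1+y_2,\,z_1+z_2+y_1x_2-x_1y_2)$ and left invariant vector fields $\mathring e_1=\partial_x+y\,\partial_z$, $\mathring e_2=\partial_y-x\,\partial_z$, $T=\partial_z$. The contact bundle is $\xi_0=\mathrm{span}(\mathring e_1,\mathring e_2)$, and $J_0\mathring e_1=\mathring e_2$, $J_0\mathring e_2=-\mathring e_1$. $\langle\cdot,\cdot\rangle$ is the Riemannian metric on $H^1$ for which $\mathring e_1,\mathring e_2,T$ are orthonormal, and $|\cdot|$ its norm. Geodesics of $H^1$ are the non-constant curves $t\mapsto(x^1(t),x^2(t),x^3(t))$ (on open intervals) for which there exist functions $\xi_1(t),\xi_2(t),\xi_3(t)$ solving the Hamiltonian system $$\dot x^k=\sum_j h^{kj}(x)\xi_j,\qquad \dot\xi_k=-\tfrac12\sum_{i,j=1}^3\frac{\partial h^{ij}}{\partial x^k}(x)\,\xi_i\xi_j,\quad k=1,2,3,$$ where $$(h^{ij})=\begin{pmatrix} 1 & 0 & x^2 \\ 0 & 1 & -x^1 \\ x^2 & -x^1 & (x^1)^2+(x^2)^2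 \end{pmatrix}$$ (here $x^1,x^2$ carry superscript indices). All curves are smooth. For a curve $\gamma$, write $\gamma'=\gamma'_{\xi_0}+\gamma'_T$ with $\gamma'_{\xi_0}\in\xi_0$, $\gamma'_T\in\mathbb{R}T$. It is horizontally regular if $\gamma'_{\xi_0}\neq0$ everywhere. Reparametrize by horizontal arc-length $s$ (orientation-preservingly, so that $|\gamma'_{\xi_0}(s)|=1$) and put $X=\gamma'_{\xi_0}(s)$, $Y=J_0X$; the $p$-curvature is $k=\langle\frac{dX}{ds},Y\rangle$ and the $T$-variation is $\tau=\langle\gamma'(s),T\rangle$, where $\frac{dX}{ds}$ is the componentwise derivative of $X$ as an $\mathbb{R}^3$-valued function (components with respect to $\partial_x,\partial_y,\partial_z$), regarded as a tangent vector at $\gamma(s)$. *)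

(* Defs.v *)
From mathcomp Require Import all_boot all_order all_algebra.
From mathcomp Require Import all_classical all_reals all_analysis.

Set Implicit Arguments.
Unset Strict Implicit.
Unset Printing Implicit Defensive.

Import Order.TTheory GRing.Theory Num.Theory.
Import numFieldNormedType.Exports.

Local Open Scope ring_scope.
Local Open Scope classical_set_scope.

Section Heisenberg.
Context {R : realType}.

Definition vec3 (a b c : R) : 'rV[R]_3 := \row_(j < 3) [:: a; b; c]`_j.

(* Points of $H^1 = \mathbb{R}^3$ and tangent vectors (in components with
   respect to $\partial_x, \partial_y, \partial_z$) are both row vectors, so
   that the coordinate $x^k$ of [p] is the entry of index $k - 1$. *)
Definition e1 (p : 'rV[R]_3) : 'rV[R]_3 := vec3 1 0 (p 0 1).
Definition e2 (p : 'rV[R]_3) : 'rV[R]_3 := vec3 0 1 (- p 0 0).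
Definition eT : 'rV[R]_3 := vec3 0 0 1.

Definition frame (p : 'rV[R]_3) : 'M[R]_3 :=
  \matrix_(a < 3) [:: e1 p; e2 p; eT]`_a.

(* Since the rows of [frame p] are the frame vectors, [v = c *m frame p] where
   [c] is the row of components of [v] in the frame. *)
Definition frame_coord (p v : 'rV[R]_3) : 'rV[R]_3 := v *m invmx (frame p).

Definition inner (p v w : 'rV[R]_3) : R :=
  \sum_(a < 3) frame_coord p v 0 a * frame_coord p w 0 a.

Definition rnorm (p v : 'rV[R]_3) : R := Num.sqrt (inner p v v).

Definition horizontal_part (p v : 'rV[R]_3) : 'rV[R]_3 :=
  frame_coord p v 0 0 *: e1 p + frame_coord p v 0 1 *: e2 p.

(* Only meaningful on $\xi_0$; the $T$-component of [v] is discarded. *)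
Definition J0 (p v : 'rV[R]_3) : 'rV[R]_3 :=
  frame_coord p v 0 0 *: e2 p - frame_coord p v 0 1 *: e1 p.

Definition hmx (p : 'rV[R]_3) : 'M[R]_3 :=
  \matrix_(i < 3) [:: vec3 1 0 (p 0 1);
                      vec3 0 1 (- p 0 0);
                      vec3 (p 0 1) (- p 0 0)
                           (p 0 0 ^+ 2 + p 0 1 ^+ 2)]`_i.

(* Curves and parameter changes are total functions whose values outside the
   interval of definition are irrelevant: all conditions below are imposed at
   points of an open interval. *)
Definition open_interval (I : set R) : Prop :=
  [/\ open I, is_interval I & I !=set0].

Definition smooth_on (V : normedModType R) (I : set R) (f : R -> V) : Prop :=
  forall (n : nat) (t : R), I t -> derivable f^`(n) t 1.

Definition curve (I : set R) (g : R -> 'rV[R]_3) : Prop :=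
  open_interval I /\ smooth_on I g.

Definition geodesic (I : set R) (g : R -> 'rV[R]_3) : Prop :=
  [/\ curve I g,
      exists t1 t2 : R, [/\ I t1, I t2 & g t1 <> g t2] &
      exists xi : R -> 'rV[R]_3, forall t : R, I t -> forall k : 'I_3,
        is_derive t 1 (fun u => g u 0 k)
          (\sum_(j < 3) hmx (g t) k j * xi t 0 j) /\
        is_derive t 1 (fun u => xi u 0 k)
          (- (1 / 2) * \sum_(i < 3) \sum_(j < 3)
             'D_(delta_mx 0 k) (fun p => hmx p i j) (g t)
             * xi t 0 i * xi t 0 j)].

Definition horizontally_regular (I : set R) (g : R -> 'rV[R]_3) : Prop :=
  curve I g /\ forall t : R, I t -> horizontal_part (g t) (derive1 g t) <> 0.

(* The parameter change replaces [g] on [I] by [g \o phi] on [J]. *)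
Definition reparametrization (J I : set R) (phi : R -> R) : Prop :=
  [/\ open_interval J, smooth_on J phi, set_bij J I phi &
      forall s : R, J s -> derive1 phi s <> 0].

Definition Xfield (g : R -> 'rV[R]_3) (s : R) : 'rV[R]_3 :=
  horizontal_part (g s) (derive1 g s).

Definition Yfield (g : R -> 'rV[R]_3) (s : R) : 'rV[R]_3 :=
  J0 (g s) (Xfield g s).

(* A horizontally regular curve has such a parameter change, unique up to a
   translation of the parameter. *)
Definition horizontal_arclength (J I : set R) (phi : R -> R)
    (g : R -> 'rV[R]_3) : Prop :=
  [/\ reparametrization J I phi,
      forall s : R, J s -> 0 < derive1 phi s &
      forall s : R, J s -> rnorm ((g \o phi) s) (Xfield (g \o phi) s) = 1].

(* [p_curvature] and [T_variation] are the invariants of the text only for a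
   curve parametrized by horizontal arc-length. *)
Definition p_curvature (g : R -> 'rV[R]_3) (s : R) : R :=
  inner (g s) (derive1 (Xfield g) s) (Yfield g s).

Definition T_variation (g : R -> 'rV[R]_3) (s : R) : R :=
  inner (g s) (derive1 g s) eT.

Definition T_variation0_p_curvature_cst (I : set R) (g : R -> 'rV[R]_3) : Prop :=
  exists (J : set R) (phi : R -> R),
    horizontal_arclength J I phi g /\
    (forall s : R, J s -> T_variation (g \o phi) s = 0) /\
    exists c : R, forall s : R, J s -> p_curvature (g \o phi) s = c.

Definition geodesic_up_to_reparametrization (I : set R) (g : R -> 'rV[R]_3) :
    Prop :=
  exists (J : set R) (phi : R -> R),
    reparametrization J I phi /\ geodesic J (g \o phi).

End Heisenberg.

(* Main.v *)
(** In coordinates [g = (x, y, z)], the Hamiltonian system conserves the momentum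
    [c] dual to [T] and, once the momenta are eliminated, it reads
      [z' = y x' - x y',  x'' = 2 c y',  y'' = - 2 c x'].
    The first equation says [tau = 0]. The other two make the squared horizontal
    speed [x'^2 + y'^2] constant, and at unit speed they are equivalent to
    [x' y'' - y' x'' = - 2 c], i.e. to constant p-curvature [- 2 c]. Since the
    equations are stable under [s |-> a s] (with [a c] for [c]), every geodesic
    can be rescaled, with either orientation, to horizontal arc-length. *)

Require Import Defs.
From mathcomp Require Import all_boot all_order all_algebra.
From mathcomp Require Import all_classical all_reals all_analysis.
From mathcomp Require Import ring.

Set Implicit Arguments.
Unset Strict Implicit.
Unset Printing Implicit Defensive.

Import Order.TTheory GRing.Theory Num.Theory.
Import numFieldNormedType.Exports.

Local Open Scope ring_scope.
Local Open Scope classical_set_scope.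

(** * Calculus on open intervals *)

Section Calculus.
Context {R : realType}.
Implicit Types (t u s : R) (I J : set R) (f h phi : R -> R) (n m : nat).

Lemma open_near_eq (V : Type) I (f h : R -> V) t :
  open I -> I t -> (forall u, I u -> f u = h u) -> \forall u \near t, f u = h u.
Proof.
move=> oI It fh; near=> u; apply: fh; near: u.
exact: open_nbhs_nbhs.
Unshelve. all: by end_near. Qed.

Lemma is_derive_derive1 (V : normedModType R) (f : R -> V) t :
  derivable f t 1 -> is_derive t 1 f (f^`() t).
Proof. by move=> df; apply: DeriveDef => //; rewrite derive1E. Qed.

Lemma derive1_val (V : normedModType R) (f : R -> V) (t : R) d :
  is_derive t 1 f d -> f^`() t = d.
Proof. by move=> df; rewrite derive1E derive_val. Qed.

Lemma derive1_congr (V : normedModType R) I (f h : R -> V) t :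
  open I -> I t -> (forall u, I u -> f u = h u) -> f^`() t = h^`() t.
Proof.
move=> oI It fh; rewrite !derive1E; apply: near_eq_derive.
exact: open_near_eq oI It fh.
Qed.

Lemma derivable_congr (V : normedModType R) I (f h : R -> V) t :
  open I -> I t -> (forall u, I u -> f u = h u) ->
  derivable f t 1 -> derivable h t 1.
Proof. by move=> oI It fh; apply: near_eq_derivable; exact: open_near_eq oI It fh. Qed.

Lemma is_derive_congr (V : normedModType R) I (f h : R -> V) (t : R) d :
  open I -> I t -> (forall u, I u -> f u = h u) ->
  is_derive t 1 f d -> is_derive t 1 h d.
Proof. by move=> oI It fh; apply: near_eq_is_derive; exact: open_near_eq oI It fh. Qed.

(** A finite-order version of smoothness, suited to induction: the derivative of a product or of a
    composite again involves products and composites, but of one order less. *)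
Definition diff_upto n I f := forall m t, (m < n)%N -> I t -> derivable f^`(m) t 1.

Lemma diff_uptoS n I f : diff_upto n.+1 I f <->
  (forall t, I t -> derivable f t 1) /\ diff_upto n I f^`().
Proof.
split=> [df|[df df'] [|m] t]; last 2 first.
- by move=> _; exact: df.
- by rewrite ltnS derive1Sn; exact: df'.
split=> [t|m t mn]; first exact: (df 0%N).
by rewrite -derive1Sn; exact: df.
Qed.

Lemma diff_uptoW n I f : diff_upto n.+1 I f -> diff_upto n I f.
Proof. by move=> df m t mn; apply: df; exact: ltnW. Qed.

Lemma diff_upto_congr n I f h : open I -> (forall u, I u -> f u = h u) ->
  diff_upto n I f -> diff_upto n I h.
Proof.
move=> oI; elim: n f h => [|n IHn] f h fh; first by move=> _ m t; rewrite ltn0.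
move=> /diff_uptoS[df df'].
apply/diff_uptoS; split=> [t It|].
  exact: (derivable_congr oI It fh (df t It)).
by apply: IHn df' => u Iu; exact: (derive1_congr oI Iu fh).
Qed.

Lemma diff_uptoD n I f h : open I ->
  diff_upto n I f -> diff_upto n I h -> diff_upto n I (f + h).
Proof.
move=> oI; elim: n f h => [|n IHn] f h; first by move=> _ _ m t; rewrite ltn0.
move=> /diff_uptoS[df df'] /diff_uptoS[dh dh'].
apply/diff_uptoS; split=> [t It|]; first exact: derivableD (df t It) (dh t It).
apply: (diff_upto_congr oI _ (IHn _ _ df' dh')) => u Iu.
apply/esym/derive1_val.
exact: is_deriveD (is_derive_derive1 (df u Iu)) (is_derive_derive1 (dh u Iu)).
Qed.

(** By Leibniz, the derivative is [f * h^]() + h * f^[()], where [f] and [h] reappear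
    undifferentiated. The induction hypothesis applies to them once their order is lowered by
    [diff_uptoW]. *)
Lemma diff_uptoM n I f h : open I ->
  diff_upto n I f -> diff_upto n I h -> diff_upto n I (f * h).
Proof.
move=> oI; elim: n f h => [|n IHn] f h Df Dh; first by move=> m t; rewrite ltn0.
have /diff_uptoS[df df'] := Df; have /diff_uptoS[dh dh'] := Dh.
apply/diff_uptoS; split=> [t It|]; first exact: derivableM (df t It) (dh t It).
have := diff_uptoD oI (IHn _ _ (diff_uptoW Df) dh') (IHn _ _ (diff_uptoW Dh) df').
apply: diff_upto_congr => // u Iu.
apply/esym/derive1_val.
exact: is_deriveM (is_derive_derive1 (df u Iu)) (is_derive_derive1 (dh u Iu)).
Qed.

(** The chain rule gives the derivative [(f^]() \o phi) * phi^[()]. The induction is over all [f]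
    with [phi] fixed, so it covers the first factor; [diff_uptoM] then handles the product. *)
Lemma diff_upto_comp n I J f phi : open J -> (forall s, J s -> I (phi s)) ->
  diff_upto n I f -> diff_upto n J phi -> diff_upto n J (f \o phi).
Proof.
move=> oJ JI; elim: n f => [|n IHn] f; first by move=> _ _ m t; rewrite ltn0.
move=> /diff_uptoS[df df'] Dphi.
have /diff_uptoS[dphi dphi'] := Dphi.
have chain s : J s -> is_derive s 1 (f \o phi) (derive1 f (phi s) * derive1 phi s).
  move=> Js; apply: is_derive1_comp; apply: is_derive_derive1; last exact: dphi.
  exact/df/JI.
apply/diff_uptoS; split=> [s Js|]; first exact: @ex_derive _ _ _ _ _ _ _ (chain s Js).
have := diff_uptoM oJ (IHn _ df' (diff_uptoW Dphi)) dphi'.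
by apply: diff_upto_congr => // s Js; apply/esym/derive1_val/chain.
Qed.

Lemma smooth_on_diff_upto I f : smooth_on I f <-> forall n, diff_upto n I f.
Proof. by split=> [sf n m t _|df n t]; [exact: sf|exact: (df n.+1)]. Qed.

(** Taking a coordinate commutes with differentiation only where the derivative of the vector map
    exists, hence the hypothesis on all orders below [n]. *)
Lemma derive1n_coord d I (g : R -> 'rV[R]_d) k n : open I ->
  (forall m t, (m < n)%N -> I t -> derivable g^`(m) t 1) ->
  forall t, I t -> (fun u => g u 0 k)^`(n) t = g^`(n) t 0 k.
Proof.
move=> oI; elim: n => [//|n IHn] dg t It.
have E u : I u -> g^`(n) u 0 k = (fun u => g u 0 k)^`(n) u.
  by move=> Iu; rewrite IHn// => m w mn; apply: dg; exact: ltnW.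
rewrite !derive1nS -(derive1_congr oI It E) !derive1E derive_mx ?mxE//.
exact: dg.
Qed.

Lemma smooth_on_coord d I (g : R -> 'rV[R]_d) : open I ->
  smooth_on I g <-> forall k, smooth_on I (fun t => g t 0 k).
Proof.
move=> oI; split=> [sg k n t It|sg n].
  have E u : I u -> g^`(n) u 0 k = (fun u => g u 0 k)^`(n) u.
    by move=> Iu; rewrite (derive1n_coord k oI _ Iu)// => m w _; exact: sg.
  apply: (derivable_congr oI It E).
  by move/derivable_mxP: (sg n t It) => /(_ 0 k).
(* Strong induction: identifying the coordinates of the [n]-th derivative uses differentiability of
   [g] at every lower order. *)
elim/ltn_ind: n => n IHn t It; apply/derivable_mxP => i k; rewrite (ord1 i).
have E u : I u -> (fun u => g u 0 k)^`(n) u = g^`(n) u 0 k.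
  by move=> Iu; rewrite (derive1n_coord k oI _ Iu)// => m w mn; exact: IHn.
exact: (derivable_congr oI It E (sg k n t It)).
Qed.

Lemma smooth_on_comp I J f phi : open J -> (forall s, J s -> I (phi s)) ->
  smooth_on I f -> smooth_on J phi -> smooth_on J (f \o phi).
Proof.
move=> oJ JI /smooth_on_diff_upto df /smooth_on_diff_upto dphi.
by apply/smooth_on_diff_upto => n; exact: diff_upto_comp oJ JI (df n) (dphi n).
Qed.

Lemma smooth_on_row_comp d I J (g : R -> 'rV[R]_d) phi : open I -> open J ->
  (forall s, J s -> I (phi s)) ->
  smooth_on I g -> smooth_on J phi -> smooth_on J (g \o phi).
Proof.
move=> oI oJ JI sg sphi; apply/(smooth_on_coord _ oJ) => k.
have sgk := (smooth_on_coord g oI).1 sg k.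
exact: (smooth_on_comp oJ JI sgk sphi).
Qed.

Lemma is_derive_scale a t : is_derive t 1 (fun s => a * s) a.
Proof. by have := is_deriveZ a (is_derive_id t (1 : R)); rewrite /GRing.scale/= mulr1. Qed.

Lemma smooth_on_scale J a : smooth_on J (fun s => a * s).
Proof.
have E : (fun s => a * s)^`() = cst a.
  by apply/funext => t; exact: derive1_val (is_derive_scale a t).
move=> [|n] t _; first exact: (@ex_derive _ _ _ _ _ _ _ (is_derive_scale a t)).
rewrite derive1Sn E.
suff [b ->] : exists b, (cst a)^`(n) = cst b :> (R -> R) by exact: derivable_cst.
elim: n => [|n [b Eb]]; first by exists a.
by exists 0; rewrite derive1nS Eb; apply/funext => u; rewrite derive1_cst.
Qed.

(** * Consequences of the mean value and intermediate value theorems *)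

Lemma is_derive0_interval_cst I f : is_interval I ->
  (forall t, I t -> is_derive t 1 f 0) -> forall s t, I s -> I t -> f s = f t.
Proof.
move=> iI df.
suff W s t : I s -> I t -> s <= t -> f s = f t.
  by move=> s t Is It; case: (leP s t) => [|/ltW] st; [|apply/esym]; apply: W.
move=> Is It st.
have sub u : u \in `[s, t]%R -> I u by rewrite in_itv/= => stu; exact: (iI _ _ Is It _ stu).
have [|u us||c _ /eqP] := @MVT_segment _ f (cst 0) s t => //.
- by apply: df; apply: sub; apply: subset_itv_oo_cc us.
- apply: derivable_within_continuous => u us; exact: @ex_derive _ _ _ _ _ _ _ (df u (sub u us)).
- by rewrite mul0r subr_eq0 => /eqP.
Qed.

Lemma neq0_interval_sg I f : is_interval I ->
  (forall t, I t -> derivable f t 1) -> (forall t, I t -> f t <> 0) ->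
  forall s t, I s -> I t -> 0 < f s -> 0 < f t.
Proof.
move=> iI df f0 s t Is It fs; rewrite ltNge; apply/negP => ft.
(* The case [t < s] is the same situation for [- f] with the endpoints exchanged; strictness there
   comes from [f t <> 0]. *)
wlog : f s t df f0 Is It fs ft / s <= t => [W|st].
  case: (leP s t) => [st|/ltW ts]; first exact: (W f s t).
  apply: (W (- f) t s _ _ It Is _ _ ts).
  - by move=> u Iu; apply: derivableN; exact: df.
  - by move=> u Iu /eqP; rewrite oppr_eq0 => /eqP; exact: f0.
  - by rewrite oppr_gt0 lt_neqAle ft andbT; apply/eqP/f0.
  - by rewrite oppr_le0 ltW.
have sub u : u \in `[s, t]%R -> I u by rewrite in_itv/= => stu; exact: (iI _ _ Is It _ stu).
have [||c cst] := @IVT _ f s t 0 st; last exact/f0/sub.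
  by apply: derivable_within_continuous => u /sub; exact: df.
by rewrite ge_min le_max ft (ltW fs) orbT.
Qed.

End Calculus.

(** * The left invariant frame and the Hamiltonian *)

Section Heis.
Context {R : realType}.
Implicit Types (p v w : 'rV[R]_3) (I J : set R) (g : R -> 'rV[R]_3).

Lemma sum3 (F : 'I_3 -> R) : \sum_(i < 3) F i = F 0 + F 1 + F 2.
Proof.
rewrite !big_ord_recr big_ord0 /= add0r; congr (F _ + F _ + F _); exact: val_inj.
Qed.

Lemma ord3P (k : 'I_3) : [\/ k = 0, k = 1 | k = 2].
Proof.
case: k => [[|[|[|//]]] ik]; [constructor 1|constructor 2|constructor 3];
  exact: val_inj.
Qed.

Lemma row3P v w : v 0 0 = w 0 0 -> v 0 1 = w 0 1 -> v 0 2 = w 0 2 -> v = w.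
Proof. by move=> E0 E1 E2; apply/rowP => k; case: (ord3P k) => ->. Qed.

Lemma vec3E (a b c : R) :
  (vec3 a b c 0 0 = a) * (vec3 a b c 0 1 = b) * (vec3 a b c 0 2 = c).
Proof. by rewrite /vec3 !mxE. Qed.

Lemma mulmx_frame v p : v *m frame p =
  vec3 (v 0 0) (v 0 1) (p 0 1 * v 0 0 - p 0 0 * v 0 1 + v 0 2).
Proof.
by apply: row3P; rewrite vec3E mxE sum3 !mxE /=; ring.
Qed.

Lemma frame_unit p : frame p \in unitmx.
Proof.
(* The frame matrix is unipotent, and its off-diagonal entries lie in the last column and are linear
   in [p]; changing the sign of [p] therefore inverts it. *)
have : frame p *m frame (- p) = 1%:M.
  apply/row_matrixP => i; rewrite row_mul mulmx_frame.
  by case: (ord3P i) => ->; apply: row3P; rewrite vec3E !mxE /=; ring.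
by move/mulmx1_unit => [].
Qed.

Lemma frame_coordE p v : frame_coord p v =
  vec3 (v 0 0) (v 0 1) (v 0 2 - p 0 1 * v 0 0 + p 0 0 * v 0 1).
Proof.
rewrite /frame_coord; apply: (canLR (mulmxK (frame_unit p))).
by rewrite mulmx_frame; apply: row3P; rewrite !vec3E//; ring.
Qed.

Lemma innerE p v w : inner p v w = v 0 0 * w 0 0 + v 0 1 * w 0 1 +
  (v 0 2 - p 0 1 * v 0 0 + p 0 0 * v 0 1) *
  (w 0 2 - p 0 1 * w 0 0 + p 0 0 * w 0 1).
Proof. by rewrite /inner sum3 !frame_coordE !vec3E. Qed.

Lemma horizontal_partE p v : horizontal_part p v =
  vec3 (v 0 0) (v 0 1) (p 0 1 * v 0 0 - p 0 0 * v 0 1).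
Proof.
by rewrite /horizontal_part !frame_coordE; apply: row3P;
  rewrite !mxE /=; ring.
Qed.

Lemma J0E p v : J0 p v =
  vec3 (- v 0 1) (v 0 0) (- p 0 0 * v 0 0 - p 0 1 * v 0 1).
Proof.
by rewrite /J0 !frame_coordE; apply: row3P; rewrite !mxE /=; ring.
Qed.

Lemma horizontal_part_eq0 p v :
  horizontal_part p v = 0 <-> v 0 0 = 0 /\ v 0 1 = 0.
Proof.
rewrite horizontal_partE; split=> [E|[E0 E1]].
  by split; [move/rowP/(_ 0): E|move/rowP/(_ 1): E]; rewrite vec3E !mxE.
by apply: row3P; rewrite vec3E !mxE// E0 E1; ring.
Qed.

Lemma rnorm_horizontal p v :
  rnorm p (horizontal_part p v) = Num.sqrt (v 0 0 ^+ 2 + v 0 1 ^+ 2).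
Proof. by rewrite /rnorm innerE horizontal_partE !vec3E; congr Num.sqrt; ring. Qed.

Lemma T_variationE g s : T_variation g s =
  derive1 g s 0 2 - g s 0 1 * derive1 g s 0 0 + g s 0 0 * derive1 g s 0 1.
Proof. by rewrite /T_variation innerE !vec3E; ring. Qed.

Lemma is_derive_coord d (p v : 'rV[R]_d) k : is_derive p v (fun q : 'rV[R]_d => q 0 k) (v 0 k).
Proof.
have dI := @derivable_id _ 'rV[R]_d p v.
apply: DeriveDef; first by move/derivable_mxP: dI => /(_ 0 k).
by have := derive_mx dI; rewrite derive_id => /rowP/(_ k); rewrite !mxE.
Qed.

Lemma is_derive_hmx p v i j : is_derive p v (fun q => hmx q i j)
  ((\matrix_(i < 3) [:: vec3 0 0 (v 0 1); vec3 0 0 (- v 0 0);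
    vec3 (v 0 1) (- v 0 0) (2 * (p 0 0 * v 0 0 + p 0 1 * v 0 1))]`_i) i j).
Proof.
have d0 := is_derive_coord p v 0; have d1 := is_derive_coord p v 1.
have dc (c : R) : is_derive p v (fun=> c) 0 by exact: is_derive_cst.
have dN : is_derive p v (fun q : 'rV[R]_3 => - q 0 0) (- v 0 0).
  exact: is_deriveN.
case: (ord3P i) => ->; case: (ord3P j) => ->;
  under eq_fun do rewrite /hmx mxE /= vec3E; rewrite mxE /= vec3E //.
(* What remains is the bottom right entry, the only quadratic one; all others are constants or
   coordinates up to sign. *)
have := is_deriveD (is_deriveX 2 d0) (is_deriveX 2 d1).
have -> : (fun q : 'rV[R]_3 => q 0 0) ^+ 2 + (fun q : 'rV[R]_3 => q 0 1) ^+ 2 =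
    (fun q => q 0 0 ^+ 2 + q 0 1 ^+ 2) by apply/funext.
move/is_derive_eq; apply; rewrite /GRing.scale/= !expr1; ring.
Qed.

End Heis.

(** * The geodesic equations *)

Section Curves.
Context {R : realType}.
Implicit Types (p v w : 'rV[R]_3) (I J : set R) (g : R -> 'rV[R]_3) (s t : R).
Implicit Types (xi : R -> 'rV[R]_3).

Lemma hmx_mulE p v k : \sum_(j < 3) hmx p k j * v 0 j =
  vec3 (v 0 0 + p 0 1 * v 0 2) (v 0 1 - p 0 0 * v 0 2)
    (p 0 1 * v 0 0 - p 0 0 * v 0 1 + (p 0 0 ^+ 2 + p 0 1 ^+ 2) * v 0 2) 0 k.
Proof.
by rewrite sum3 /hmx !mxE; case: (ord3P k) => -> /=; rewrite !vec3E /=; ring.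
Qed.

(** The matrix does not depend on z, so the third component vanishes. The brackets in the other two
    are the velocities y' and x' found in [hmx_mulE], so along a solution the force is (xi_3 y', -
    xi_3 x', 0). *)
Lemma hmx_forceE p v k :
  - (1 / 2) * \sum_(i < 3) \sum_(j < 3)
    'D_(delta_mx 0 k) (fun q => hmx q i j) p * v 0 i * v 0 j =
  vec3 (v 0 2 * (v 0 1 - p 0 0 * v 0 2)) (- v 0 2 * (v 0 0 + p 0 1 * v 0 2)) 0 0 k.
Proof.
have E i j := @derive_val _ _ _ _ _ _ _ (is_derive_hmx p (delta_mx 0 k) i j).
by rewrite !sum3 !E !mxE; case: (ord3P k) => -> /=; rewrite ?mxE /= ?vec3E /=; field.
Qed.

Lemma is_derive_row d (g : R -> 'rV[R]_d) t (v : 'rV[R]_d) :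
  (forall k, is_derive t 1 (fun u => g u 0 k) (v 0 k)) <-> is_derive t 1 g v.
Proof.
split=> [dg|dg k].
  have dgt : derivable g t 1.
    by apply/derivable_mxP => i k; rewrite (ord1 i); exact: ex_derive.
  by apply: DeriveDef => //; rewrite derive_mx//; apply/rowP => k; rewrite mxE derive_val.
have dgt : derivable g t 1 by exact: ex_derive.
apply: DeriveDef; first by move/derivable_mxP: dgt => /(_ 0 k).
by rewrite -(@derive_val _ _ _ _ _ _ _ dg) derive_mx// mxE.
Qed.

Lemma curve_derive1 I g t k : curve I g -> I t ->
  is_derive t 1 (fun u => g u 0 k) (derive1 g t 0 k).
Proof.
move=> [_ sg] It; apply/is_derive_row: k; apply: is_derive_derive1.
exact: (sg 0%N).
Qed.

Lemma curve_derive2 I g t k : curve I g -> I t ->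
  is_derive t 1 (fun u => derive1 g u 0 k) (derive1 (derive1 g) t 0 k).
Proof.
move=> [_ sg] It; apply/is_derive_row: k; apply: is_derive_derive1.
exact: (sg 1%N).
Qed.

(** [Yfield] is horizontal with frame components (- y', x'), and the frame is orthonormal. Only the
    first two components (x'', y'') of the derivative of [Xfield] contribute. *)
Lemma p_curvatureE I g t : curve I g -> I t -> p_curvature g t =
  derive1 g t 0 0 * derive1 (derive1 g) t 0 1 -
  derive1 g t 0 1 * derive1 (derive1 g) t 0 0.
Proof.
move=> cg It.
have d0 := curve_derive1 0 cg It; have d1 := curve_derive1 1 cg It.
have e0 := curve_derive2 0 cg It; have e1 := curve_derive2 1 cg It.
have /derive1_val dX : is_derive t 1 (Xfield g)
    (vec3 (derive1 (derive1 g) t 0 0) (derive1 (derive1 g) t 0 1)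
      (g t 0 1 * derive1 (derive1 g) t 0 0 + derive1 g t 0 0 * derive1 g t 0 1 -
       (g t 0 0 * derive1 (derive1 g) t 0 1 + derive1 g t 0 1 * derive1 g t 0 0))).
  apply/is_derive_row => k; case: (ord3P k) => ->; rewrite vec3E.
  - under eq_fun do rewrite /Xfield horizontal_partE vec3E.
    exact: e0.
  - under eq_fun do rewrite /Xfield horizontal_partE vec3E.
    exact: e1.
  - under eq_fun do rewrite /Xfield horizontal_partE vec3E.
    exact: is_deriveB (is_deriveM d1 e0) (is_deriveM d0 e1).
rewrite /p_curvature dX innerE /Yfield J0E /Xfield horizontal_partE !vec3E.
move: (derive1 (derive1 g) t) (derive1 g t) (g t) => w v p; ring.
Qed.

(** The equations with the momenta eliminated: the curve is horizontal and its planar velocity (x',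
    y') rotates at the constant angular velocity - 2 c. *)
Definition geodesic_ode I g c := forall t, I t ->
  [/\ derive1 g t 0 2 = g t 0 1 * derive1 g t 0 0 - g t 0 0 * derive1 g t 0 1,
      derive1 (derive1 g) t 0 0 = 2 * c * derive1 g t 0 1 &
      derive1 (derive1 g) t 0 1 = - (2 * c) * derive1 g t 0 0].

(** The clause on momenta in [geodesic], with the momenta as a parameter. *)
Definition hamiltonian_system I g xi := forall t, I t -> forall k : 'I_3,
  is_derive t 1 (fun u => g u 0 k)
    (\sum_(j < 3) hmx (g t) k j * xi t 0 j) /\
  is_derive t 1 (fun u => xi u 0 k)
    (- (1 / 2) * \sum_(i < 3) \sum_(j < 3)
       'D_(delta_mx 0 k) (fun p => hmx p i j) (g t) * xi t 0 i * xi t 0 j).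

Lemma geodesic_ode_of_hamiltonian I g xi : curve I g ->
  hamiltonian_system I g xi -> exists c, geodesic_ode I g c.
Proof.
move=> cg H; have [[oI iI [t0 It0]] _] := cg.
have Eg t k : I t -> derive1 g t 0 k = vec3 (xi t 0 0 + g t 0 1 * xi t 0 2)
    (xi t 0 1 - g t 0 0 * xi t 0 2) (g t 0 1 * xi t 0 0 - g t 0 0 * xi t 0 1 +
      (g t 0 0 ^+ 2 + g t 0 1 ^+ 2) * xi t 0 2) 0 k.
  move=> It; have [dg _] := H t It k; rewrite -hmx_mulE.
  rewrite -(@derive_val _ _ _ _ _ _ _ dg).
  by rewrite (@derive_val _ _ _ _ _ _ _ (curve_derive1 k cg It)).
have Dxi t k : I t -> is_derive t 1 (fun u => xi u 0 k)
    (vec3 (xi t 0 2 * derive1 g t 0 1) (- xi t 0 2 * derive1 g t 0 0) 0 0 k).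
  by move=> It; have [_] := H t It k; rewrite hmx_forceE !Eg// !vec3E.
(* No force acts on the momentum dual to T; its value at the base point [t0] is the constant [c]. *)
have Exi t : I t -> xi t 0 2 = xi t0 0 2.
  move=> It; apply: (is_derive0_interval_cst (f := fun t => xi t 0 2) iI) => // u Iu.
  by have := Dxi u 2 Iu; rewrite vec3E.
exists (xi t0 0 2) => t It.
have d0 := curve_derive1 0 cg It; have d1 := curve_derive1 1 cg It.
have x0 := Dxi t 0 It; have x1 := Dxi t 1 It; have x2 := Dxi t 2 It.
rewrite !vec3E in x0 x1 x2.
split.
- by rewrite !Eg// !vec3E; ring.
(* Differentiate x' = xi_1 + y xi_3 with xi_3 constant: each of the two terms contributes xi_3 y',
   whence the factor 2. The equation for y'' arises in the same way. *)
- have dd : is_derive t 1 (fun u => derive1 g u 0 0)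
      (xi t 0 2 * derive1 g t 0 1 + (g t 0 1 * 0 + xi t 0 2 * derive1 g t 0 1)).
    apply: (is_derive_congr oI It (f := fun u => xi u 0 0 + g u 0 1 * xi u 0 2)).
      by move=> u Iu; rewrite Eg// vec3E.
    exact: is_deriveD x0 (is_deriveM d1 x2).
  rewrite -(@derive_val _ _ _ _ _ _ _ (curve_derive2 0 cg It)) derive_val Exi//.
  ring.
- have dd : is_derive t 1 (fun u => derive1 g u 0 1)
      (- xi t 0 2 * derive1 g t 0 0 - (g t 0 0 * 0 + xi t 0 2 * derive1 g t 0 0)).
    apply: (is_derive_congr oI It (f := fun u => xi u 0 1 - g u 0 0 * xi u 0 2)).
      by move=> u Iu; rewrite Eg// vec3E.
    exact: is_deriveB x1 (is_deriveM d0 x2).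
  rewrite -(@derive_val _ _ _ _ _ _ _ (curve_derive2 1 cg It)) derive_val Exi//.
  ring.
Qed.

(** The momenta are obtained by solving the first two velocity equations for xi_1 and xi_2 with xi_3
    = c. The third velocity equation is then horizontality, and the momentum equations are those for
    x'' and y''. *)
Lemma hamiltonian_of_geodesic_ode I g c : curve I g -> geodesic_ode I g c ->
  hamiltonian_system I g (fun t => vec3 (derive1 g t 0 0 - g t 0 1 * c)
    (derive1 g t 0 1 + g t 0 0 * c) c).
Proof.
move=> cg H t It k; have [E2 E0 E1] := H t It.
rewrite hmx_mulE hmx_forceE !vec3E.
have d0 := curve_derive1 0 cg It; have d1 := curve_derive1 1 cg It.
have d2 := curve_derive1 2 cg It.
have e0 := curve_derive2 0 cg It; have e1 := curve_derive2 1 cg It.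
have dc := is_derive_cst c t (1 : R).
case: (ord3P k) => ->; rewrite !vec3E; split.
- apply: (is_derive_eq d0); ring.
- under eq_fun do rewrite vec3E.
  apply: (is_derive_eq (is_deriveB e0 (is_deriveM d1 dc))).
  by rewrite /GRing.scale/= E0; ring.
- apply: (is_derive_eq d1); ring.
- under eq_fun do rewrite vec3E.
  apply: (is_derive_eq (is_deriveD e1 (is_deriveM d0 dc))).
  by rewrite /GRing.scale/= E1; ring.
- apply: (is_derive_eq d2); rewrite E2; ring.
- under eq_fun do rewrite vec3E.
  exact: dc.
Qed.

End Curves.

(** * Horizontal speed and changes of parameter *)

Section Main.
Context {R : realType}.
Implicit Types (p v w : 'rV[R]_3) (I J K : set R) (g : R -> 'rV[R]_3) (s t : R).
Implicit Types (phi psi : R -> R) (c a : R).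

Definition hspeed2 g t := derive1 g t 0 0 ^+ 2 + derive1 g t 0 1 ^+ 2.

Lemma is_derive_hspeed2 I g t : curve I g -> I t -> is_derive t 1 (hspeed2 g)
  (2 * (derive1 g t 0 0 * derive1 (derive1 g) t 0 0 +
        derive1 g t 0 1 * derive1 (derive1 g) t 0 1)).
Proof.
move=> cg It.
have e0 := curve_derive2 0 cg It; have e1 := curve_derive2 1 cg It.
have := is_deriveD (is_deriveX 2 e0) (is_deriveX 2 e1).
have -> : (fun u => derive1 g u 0 0) ^+ 2 + (fun u => derive1 g u 0 1) ^+ 2 =
  hspeed2 g by apply/funext.
move/is_derive_eq; apply; rewrite /GRing.scale/= !expr1.
by move: (derive1 (derive1 g) t) (derive1 g t) => w v; ring.
Qed.

Lemma horizontal_part_neq0 g t :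
  horizontal_part (g t) (derive1 g t) <> 0 <-> 0 < hspeed2 g t.
Proof.
have q0 : 0 <= hspeed2 g t by rewrite addr_ge0// sqr_ge0.
split=> [n0|]; last first.
  move=> q1 /horizontal_part_eq0[E0 E1]; move: q1.
  by rewrite /hspeed2 E0 E1 expr0n addr0 ltxx.
rewrite lt_neqAle q0 andbT; apply/eqP => /esym/eqP.
rewrite paddr_eq0 ?sqr_ge0// !sqrf_eq0 => /andP[/eqP E0 /eqP E1].
by apply: n0; apply/horizontal_part_eq0.
Qed.

Lemma unit_speed_iff g s :
  rnorm (g s) (Xfield g s) = 1 <-> hspeed2 g s = 1.
Proof.
rewrite rnorm_horizontal -/(hspeed2 g s); split=> [E|->]; last exact: sqrtr1.
by rewrite -[LHS]sqr_sqrtr ?E ?expr1n// addr_ge0// sqr_ge0.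
Qed.

(** At unit speed the planar acceleration is orthogonal to the planar velocity, so it equals the
    p-curvature times the rotated velocity (- y', x'). The p-curvature thus determines x'' and
    y''. *)
Lemma geodesic_ode_unit_speed I g : curve I g ->
  (forall t, I t -> hspeed2 g t = 1) ->
  ((forall t, I t -> T_variation g t = 0) /\
   exists c, forall t, I t -> p_curvature g t = c) <->
  exists c, geodesic_ode I g c.
Proof.
move=> cg g1; have [[oI _ _] _] := cg; split=> [[T0 [c kc]]|[c H]]; last first.
  split=> [t It|]; first by have [E2 _ _] := H t It; rewrite T_variationE E2; ring.
  exists (- (2 * c)) => t It; have [_ E0 E1] := H t It.
  rewrite (p_curvatureE cg It) E0 E1 -[RHS]mulr1 -(g1 t It) /hspeed2.
  by move: (derive1 g t) => v; ring.
(* Here [c] is the p-curvature, which is - 2 times the constant of the equations. *)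
exists (- (c / 2)) => t It.
have orth : derive1 g t 0 0 * derive1 (derive1 g) t 0 0 +
    derive1 g t 0 1 * derive1 (derive1 g) t 0 1 = 0.
  have d0 : is_derive t 1 (hspeed2 g) 0.
    apply: (is_derive_congr oI It (f := cst (1 : R))) => u Iu.
    by rewrite g1.
  have := @derive_val _ _ _ _ _ _ _ (is_derive_hspeed2 cg It).
  rewrite derive_val => /esym/eqP; rewrite mulf_eq0 pnatr_eq0 /=.
  by move/eqP.
have := T0 t It; have := kc t It; have := g1 t It.
rewrite (p_curvatureE cg It) T_variationE /hspeed2.
move: orth; move: (derive1 (derive1 g) t) (derive1 g t) (g t) => w v p.
move=> orth q1 k0 tau0; split.
- apply/eqP; rewrite -subr_eq0 -tau0; apply/eqP; ring.
(* Expansion of the acceleration [w] in the basis (x', y'), (- y', x'), with a correction term that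
   vanishes at unit speed. *)
- have -> : w 0 0 = v 0 0 * (v 0 0 * w 0 0 + v 0 1 * w 0 1) -
      v 0 1 * (v 0 0 * w 0 1 - v 0 1 * w 0 0) +
      w 0 0 * (1 - (v 0 0 ^+ 2 + v 0 1 ^+ 2)) by ring.
  by rewrite orth k0 q1; field.
- have -> : w 0 1 = v 0 1 * (v 0 0 * w 0 0 + v 0 1 * w 0 1) +
      v 0 0 * (v 0 0 * w 0 1 - v 0 1 * w 0 0) +
      w 0 1 * (1 - (v 0 0 ^+ 2 + v 0 1 ^+ 2)) by ring.
  by rewrite orth k0 q1; field.
Qed.

Lemma geodesic_ode_hspeed2 I g c : curve I g -> geodesic_ode I g c ->
  forall s t, I s -> I t -> hspeed2 g s = hspeed2 g t.
Proof.
move=> cg H; have [[_ iI _] _] := cg.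
apply: is_derive0_interval_cst => // t It.
apply: (is_derive_eq (is_derive_hspeed2 cg It)).
by have [_ -> ->] := H t It; move: (derive1 g t) => v; ring.
Qed.

(** Horizontal speed is conserved, so one zero forces x' = y' = 0 throughout; horizontality then
    gives z' = 0 and the curve would be constant. *)
Lemma geodesic_ode_hspeed2_gt0 I g c : curve I g -> geodesic_ode I g c ->
  (exists t1 t2, [/\ I t1, I t2 & g t1 <> g t2]) ->
  forall t, I t -> 0 < hspeed2 g t.
Proof.
move=> cg H [t1 [t2 [It1 It2 g12]]] t It; have [[_ iI _] _] := cg.
apply/horizontal_part_neq0 => /horizontal_part_eq0[E0 E1]; apply: g12.
have q0 : hspeed2 g t = 0 by rewrite /hspeed2 E0 E1 expr0n addr0.
have z u : I u -> derive1 g u = 0.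
  move=> Iu; have qu : hspeed2 g u = 0 by rewrite -q0; exact: geodesic_ode_hspeed2 cg H _ _ Iu It.
  move/eqP: qu; rewrite /hspeed2 paddr_eq0 ?sqr_ge0// !sqrf_eq0.
  move=> /andP[/eqP u0 /eqP u1]; apply: row3P; rewrite ?u0 ?u1 ?mxE//.
  by have [-> _ _] := H u Iu; rewrite u0 u1; ring.
apply/rowP => k; apply: (is_derive0_interval_cst (f := fun t => g t 0 k) iI) => // u Iu.
by have := curve_derive1 k cg Iu; rewrite z// mxE.
Qed.

Lemma nonconstant_of_hspeed2 I g : curve I g ->
  (forall t, I t -> 0 < hspeed2 g t) ->
  exists t1 t2, [/\ I t1, I t2 & g t1 <> g t2].
Proof.
move=> cg q0; have [[oI _ [t It]] _] := cg.
apply: contrapT => cst_g; have := q0 t It; apply/negP; rewrite -leNgt.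
have E u : I u -> g t = g u.
  by move=> Iu; apply: contrapT => gtu; apply: cst_g; exists t, u.
rewrite /hspeed2; have -> : derive1 g t = 0; last by rewrite !mxE expr0n addr0.
rewrite -(derive1_congr oI It (f := cst (g t)))//; exact: derive1_cst.
Qed.

(** * Rescaling and composing changes of parameter *)

Lemma open_interval_scale J a : a != 0 -> open_interval J ->
  open_interval [set s | J (a * s)].
Proof.
move=> a0 [oJ iJ [t Jt]]; split.
- apply: (@open_comp _ _ (fun s : R => a * s) J) => // s _.
  exact: mulrl_continuous.
- move=> x y Jx Jy z /andP[xz zy]; have [a_ge0|a_lt0] := leP 0 a.
    by apply: (iJ _ _ Jx Jy); rewrite !ler_wpM2l.
  by apply: (iJ _ _ Jy Jx); rewrite !ler_wnM2l// ltW.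
- by exists (a^-1 * t) => /=; rewrite mulrA divff// mul1r.
Qed.

Lemma reparametrization_scale J a : a != 0 -> open_interval J ->
  reparametrization [set s | J (a * s)] J (fun s => a * s).
Proof.
move=> a0 oJ; split; [exact: open_interval_scale|exact: smooth_on_scale| |].
  split=> [s//|s t _ _ |t Jt]; first exact: mulfI.
  by exists (a^-1 * t) => /=; rewrite mulrA divff// mul1r.
by move=> s _; rewrite (derive1_val (is_derive_scale a s)); exact/eqP.
Qed.

Lemma derive1_reparametrization I J K phi psi s :
  reparametrization J I phi -> reparametrization K J psi -> K s ->
  derive1 (phi \o psi) s = derive1 phi (psi s) * derive1 psi s.
Proof.
move=> [_ sphi _ _] [_ spsi bpsi _] Ks; apply: derive1_comp.
  exact: (spsi 0%N).
apply: (sphi 0%N); have [KJ _ _] := bpsi; exact: KJ.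
Qed.

Lemma reparametrization_comp I J K phi psi :
  reparametrization J I phi -> reparametrization K J psi ->
  reparametrization K I (phi \o psi).
Proof.
move=> rphi rpsi; have [[oJ _ _] sphi bphi phi0] := rphi.
have [[oK iK nK] spsi bpsi psi0] := rpsi; have [KJ _ _] := bpsi.
split; [by split|exact: smooth_on_comp oK KJ sphi spsi|
  exact: set_bij_comp bpsi bphi|].
move=> s Ks; rewrite (derive1_reparametrization rphi rpsi Ks) => /eqP.
rewrite mulf_eq0 => /orP[]/eqP; [exact/phi0/KJ|exact: psi0].
Qed.

Lemma curve_reparametrization I J g phi : curve I g ->
  reparametrization J I phi -> curve J (g \o phi).
Proof.
move=> [[oI _ _] sg] [oJ sphi [JI _ _] _]; split; first exact: oJ.
by have [opJ _ _] := oJ; exact: smooth_on_row_comp oI opJ JI sg sphi.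
Qed.

Lemma derive1_scale (g : R -> 'rV[R]_3) a s : derivable g (a * s) 1 ->
  derive1 (fun u => g (a * u)) s = a *: derive1 g (a * s).
Proof.
move=> dg; apply: derive1_val; apply/is_derive_row => k; rewrite mxE mulrC.
apply: (is_derive1_comp (f := fun u => g u 0 k)) (is_derive_scale a s).
by apply/is_derive_row: k; exact: is_derive_derive1.
Qed.

Lemma derive1_curve_scale I g a s : curve I g -> I (a * s) ->
  derive1 (fun u => g (a * u)) s = a *: derive1 g (a * s).
Proof. by move=> [_ sg] Is; apply: derive1_scale; exact: (sg 0%N). Qed.

(** First derivatives acquire a factor [a] and second ones [a ^+ 2]. The horizontality equation is
    homogeneous, and in the other two the extra factor is absorbed by the constant. *)
Lemma geodesic_ode_scale I g c a : a != 0 -> curve I g -> geodesic_ode I g c ->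
  geodesic_ode [set s | I (a * s)] (fun s => g (a * s)) (a * c).
Proof.
move=> a0 cg H s Is; have [E2 E0 E1] := H _ Is; have [oI sg] := cg.
have [oJ _ _] := open_interval_scale a0 oI.
have -> : derive1 (derive1 (fun u => g (a * u))) s = a ^+ 2 *: derive1 (derive1 g) (a * s).
  rewrite (derive1_congr oJ Is (h := fun u => a *: derive1 g (a * u))); last first.
    by move=> u Iu; exact: derive1_curve_scale cg Iu.
  have d1 : derivable (derive1 g) (a * s) 1 by exact: (sg 1%N).
  have ad1 : derivable (a \*: derive1 g) (a * s) 1 by exact: derivableZ.
  rewrite (derive1_scale ad1) expr2 -scalerA; congr (a *: _).
  exact: (derive1_val (is_deriveZ a (is_derive_derive1 d1))).
rewrite (derive1_curve_scale cg Is) /=.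
move: (derive1 (derive1 g) (a * s)) (derive1 g (a * s)) (g (a * s)) E2 E0 E1.
by move=> w v p E2 E0 E1; rewrite !mxE E2 E0 E1; split; ring.
Qed.

Lemma hspeed2_scale I g a s : curve I g -> I (a * s) ->
  hspeed2 (fun u => g (a * u)) s = a ^+ 2 * hspeed2 g (a * s).
Proof.
by move=> cg Is; rewrite /hspeed2 (derive1_curve_scale cg Is) !mxE !exprMn mulrDr.
Qed.

(** * The two directions of the characterization *)

Lemma horizontally_regular_of_geodesic I g :
  geodesic I g -> horizontally_regular I g.
Proof.
move=> [cg nc [xi /(geodesic_ode_of_hamiltonian cg)[c H]]]; split=> // t It.
by apply/horizontal_part_neq0; exact: geodesic_ode_hspeed2_gt0 cg H nc t It.
Qed.

(** The horizontal arc-length parameter itself serves: at unit speed the two conditions amount to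
    the geodesic equations, and a curve of unit horizontal speed is not constant. *)
Lemma geodesic_of_T_variation0_p_curvature_cst I g : horizontally_regular I g ->
  T_variation0_p_curvature_cst I g -> geodesic_up_to_reparametrization I g.
Proof.
move=> [cg _] [J [phi [[rphi _ unit_g] [T0 kc]]]].
exists J, phi; split=> //.
have cG := curve_reparametrization cg rphi.
have q1 s : J s -> hspeed2 (g \o phi) s = 1.
  by move=> Js; apply/unit_speed_iff; exact: unit_g.
have [c H] := (geodesic_ode_unit_speed cG q1).1 (conj T0 kc).
split=> //.
  by apply: (nonconstant_of_hspeed2 cG) => s /q1 ->.
by eexists; exact: hamiltonian_of_geodesic_ode cG H.
Qed.

(* The speed [q] of a geodesic is constant, so rescaling its parameter by
   [+- 1 / q] yields unit speed; the sign restores the orientation of [g]. *)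
Lemma T_variation0_p_curvature_cst_of_geodesic I g : curve I g ->
  geodesic_up_to_reparametrization I g -> T_variation0_p_curvature_cst I g.
Proof.
move=> cg [J [phi [rphi [cG nc [xi /(geodesic_ode_of_hamiltonian cG)[c H]]]]]].
have [[oJ iJ [s0 Js0]] _] := cG; have [ooJ sphi _ phi0] := rphi.
have q_gt0 := geodesic_ode_hspeed2_gt0 cG H nc.
pose q := Num.sqrt (hspeed2 (g \o phi) s0).
have q0 : 0 < q by rewrite sqrtr_gt0; exact: q_gt0.
pose a := if 0 < derive1 phi s0 then q^-1 else - q^-1.
have a2 : a ^+ 2 * q ^+ 2 = 1.
  by rewrite /a; case: ifP => _; rewrite ?sqrrN -exprMn mulVf ?gt_eqF// expr1n.
have a0 : a != 0.
  by apply/eqP => a0; move/eqP: a2; rewrite a0 expr0n mul0r eq_sym oner_eq0.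
(* The choice of [a] makes this product positive at [s0]; it is continuous and never zero on the
   interval, so it keeps its sign. *)
have phia_gt0 s : J s -> 0 < derive1 phi s * a.
  move=> Js; apply: (neq0_interval_sg (f := fun s => derive1 phi s * a) iJ _ _ Js0 Js).
  - move=> u Ju; apply: derivableM; last exact: derivable_cst.
    exact: (sphi 1%N).
  - by move=> u Ju /eqP; rewrite mulf_eq0 (negPf a0) orbF => /eqP; exact: phi0.
  - rewrite /a; case: ifPn => [d_gt0|]; first by rewrite mulr_gt0// invr_gt0.
    rewrite -leNgt le_eqVlt => /orP[/eqP/(phi0 _ Js0)//|d_lt0].
    by rewrite nmulr_rgt0// oppr_lt0 invr_gt0.
pose K := [set s | J (a * s)]; pose psi s := a * s.
have rpsi : reparametrization K J psi by exact: reparametrization_scale.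
have rphipsi := reparametrization_comp rphi rpsi.
have cGpsi := curve_reparametrization cg rphipsi.
have q1 s : K s -> hspeed2 (g \o (phi \o psi)) s = 1.
  move=> Ks; have := hspeed2_scale cG Ks; rewrite /= => ->.
  rewrite (geodesic_ode_hspeed2 cG H Ks Js0) -a2 sqr_sqrtr// ltW//.
  exact: q_gt0.
have Hpsi : geodesic_ode K (g \o (phi \o psi)) (a * c).
  exact: (geodesic_ode_scale a0 cG H).
have [T0 kc] := (geodesic_ode_unit_speed cGpsi q1).2 (ex_intro _ _ Hpsi).
exists K, (phi \o psi); split=> //; split=> // s Ks; last first.
  by apply/unit_speed_iff; exact: q1.
rewrite (derive1_reparametrization rphi rpsi Ks).
by rewrite (derive1_val (is_derive_scale a s)); exact: phia_gt0.
Qed.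

End Main.

Theorem theorem1p5 (R : realType) :
  (forall (I : set R) (g : R -> 'rV[R]_3), horizontally_regular I g ->
     (geodesic_up_to_reparametrization I g <->
      T_variation0_p_curvature_cst I g)) /\
  (forall (I : set R) (g : R -> 'rV[R]_3), geodesic I g ->
     horizontally_regular I g /\ T_variation0_p_curvature_cst I g).
Proof.
split=> I g Hg.
  split; last exact: geodesic_of_T_variation0_p_curvature_cst.
  by apply: T_variation0_p_curvature_cst_of_geodesic; have [] := Hg.
have rg := horizontally_regular_of_geodesic Hg; split=> //.
have [cg _] := rg; apply: T_variation0_p_curvature_cst_of_geodesic => //.
(* A geodesic is a geodesic up to the identity parameter change, obtained here as the rescaling by
   1. *)
have [oI _] := cg; have := reparametrization_scale (oner_neq0 R) oI.
have -> : (fun s : R => 1 * s) = id by apply/funext => s; rewrite mul1r.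
have -> : [set s | I (1 * s)] = I by apply/funext => s /=; rewrite mul1r.
by exists I, id.
Qed.
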